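(* Let $a,b\in\mathbb{R}$ with $a<b$, and let $P$ be the uniform distribution on the line segment (closed interval) $[a,b]\subset\mathbb{R}$. Then the ($1$-dimensional) conditional quantization coefficients for $P$ with respect to the conditional sets $\{a,b\}$, $\{a\}$, and $\{b\}$ exist as finite positive numbers and each equals $\frac{(a-b)^2}{12}$. That is, for each of these three conditional sets, $\lim_{n\to\infty}n^2(V_n(P)-V_\infty(P))=\frac{(a-b)^2}{12}$.
   Context: The uniform distribution on $[a,b]$ has density $\frac{1}{b-a}$ on $[a,b]$ and $0$ elsewhere. Let $P$ be a Borel probability measure on $\mathbb{R}$ with finite second moment, let $\beta\subset\mathbb{R}$ be a finite set with $\mathrm{card}(\beta)=\ell\ge1$, and let $n\ge\ell$ be an integer. The $n$th conditional (unconstrained) quantization error for $P$ with respect to the conditional set $\beta$ is $$V_n(P)=\inf_{\alpha}\Big\{\int\min_{c\in\alpha\cup\beta}|x-c|^2\,dP(x) : \alpha\subseteq\mathbb{R},\ 0\le\mathrm{card}(\alpha)\le n-\ell\Big\}.$$ Put $V_\infty(P)=\lim_{n\to\infty}V_n(P)$. For $\kappa>0$, the $\kappa$-dimensional conditional quantization coefficient of $P$ with respect to $\beta$ is $\lim_{n\to\infty}n^{2/\kappa}(V_n(P)-V_\infty(P))$, if this limit exists; here $\kappa=1$. *)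

(* Defs.v *)
From mathcomp Require Export all_boot all_order all_algebra finmap.
From mathcomp Require Export all_classical all_reals all_analysis.

Set Implicit Arguments.
Unset Strict Implicit.
Unset Printing Implicit Defensive.

Import Order.TTheory GRing.Theory Num.Theory.
Import numFieldNormedType.Exports.

Local Open Scope classical_set_scope.
Local Open Scope ring_scope.
Local Open Scope ereal_scope.

(* The minimum is taken in [\bar R], where [+oo] is neutral for [mine]; it is
   a genuine minimum over [A] as soon as [A] is nonempty. *)
Definition min_sqdist (R : realType) (A : {fset R}) (x : R) : \bar R :=
  \big[mine/+oo]_(c <- A) (`|x - c| ^+ 2)%:E.

(* The subtraction [n - #|` beta|] is truncated, so the value is meaningful
   only for [#|` beta| <= n]; this has no effect on limits in [n]. *)
Definition cond_quant_error (R : realType)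
    (P : probability (measurableTypeR R) R) (beta : {fset R}) (n : nat)
    : \bar R :=
  ereal_inf [set \int[P]_x min_sqdist (alpha `|` beta)%fset x
            | alpha in [set alpha : {fset R} | (#|` alpha| <= n - #|` beta|)%N]].

Definition cond_quant_error_lim (R : realType)
    (P : probability (measurableTypeR R) R) (beta : {fset R}) : \bar R :=
  limn (cond_quant_error P beta).

(* [limn] returns an arbitrary value on divergent sequences, hence the explicit
   convergence requirement. The coefficient [c] is a real, so finite. *)
Definition is_cond_quant_coef (R : realType) (kappa : R)
    (P : probability (measurableTypeR R) R) (beta : {fset R}) (c : R) : Prop :=
  cvgn (cond_quant_error P beta) /\
  (n%:R `^ (2 / kappa))%:E *
    (cond_quant_error P beta n - cond_quant_error_lim P beta)
    @[n --> \oo] --> c%:E.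

(* Main.v *)
Require Import Defs.
From mathcomp Require Import measurable_realfun ring lra.
Set Implicit Arguments.
Unset Strict Implicit.
Unset Printing Implicit Defensive.

Import Order.TTheory GRing.Theory Num.Theory.
Import numFieldNormedType.Exports.
Local Open Scope classical_set_scope.
Local Open Scope ring_scope.

(* Among the error integrals with at most n points the smallest is
   (b - a)^2 / (12 n^2). With t = (b - a) / (2 n), integrate
   t^2 <= min_c (x - c)^2 + \sum_c max(0, t^2 - (x - c)^2) over [a, b]: each
   summand contributes at most 4 t^3 / 3, whatever the position of c. On the
   other side, the n - card(beta) points of alpha alone, placed at the midpoints
   of equal cells, give the error (b - a)^2 / (12 (n - card(beta))^2). The two
   bounds agree after multiplication by n^2 in the limit, for every finite
   conditional set beta. *)

(** * Integrals of quadratic functions over intervals *)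

Lemma integral_is_derive (R : realType) (f F : R -> R) (a b : R) : a < b ->
  continuous f -> (forall x : R, is_derive x 1 F (f x)) ->
  (\int[lebesgue_measure]_(x in `[a, b]) (f x)%:E = (F b - F a)%:E)%E.
Proof.
move=> ab cf dF.
have cF : continuous F.
  by move=> x; apply/differentiable_continuous/derivable1_diffP; case: (dF x).
rewrite (@continuous_FTC2 _ f F)//.
- exact: continuous_subspaceT.
- split => [x _||].
  + by case: (dF x).
  + exact/cvg_at_right_filter/cF.
  + exact/cvg_at_left_filter/cF.
- by move=> x _; rewrite derive1E; apply: derive_val.
Qed.

Lemma continuous_sqrB (R : realType) (c : R) :
  continuous (fun x : R => (x - c) ^+ 2).
Proof.
move=> x; apply: (@continuous_comp _ _ _ (fun y : R => y - c : R)
  (fun y : R => y ^+ 2)); last exact: exprn_continuous.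
by apply: continuousB => //; exact: cst_continuous.
Qed.

(** This is the error of one cell of half-width [t] served by its midpoint, the unit of the upper
    bound. *)
Lemma integral_sqr_centered (R : realType) (c t : R) : 0 < t ->
  (\int[lebesgue_measure]_(x in `[(c - t)%R, (c + t)%R]) ((x - c) ^+ 2)%:E
   = (2 / 3 * t ^+ 3)%:E)%E.
Proof.
move=> t0; pose F (x : R) := (x - c) ^+ 3 / 3.
have dF (x : R) : is_derive x 1 F ((x - c) ^+ 2).
  by apply: is_derive_eq; rewrite /GRing.scale/=; field.
rewrite (integral_is_derive _ _ dF).
- by congr EFin; rewrite /F; field.
- lra.
- exact: continuous_sqrB.
Qed.

(** The amount by which the squared distance to [c] falls short of [t ^+ 2], cut off at 0: a
    parabolic cap supported on [c - t, c + t]. *)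
Definition bump (R : realType) (t c x : R) : R :=
  Num.max 0 (t ^+ 2 - (x - c) ^+ 2).

Lemma continuous_sub_sqr (R : realType) (t c : R) :
  continuous (fun x : R => t ^+ 2 - (x - c) ^+ 2).
Proof.
move=> x; apply: (@continuousB _ _ _ (fun=> t ^+ 2 : R)
  (fun y : R => (y - c) ^+ 2 : R)); first exact: cst_continuous.
exact: continuous_sqrB.
Qed.

Lemma measurable_bump (R : realType) (t c : R) :
  measurable_fun setT (bump t c).
Proof.
apply: measurable_maxr => //.
by apply: continuous_measurable_fun; exact: continuous_sub_sqr.
Qed.

(** By nonnegativity the worst domain is the whole line, where the cap has mass 2 t^3 - 2 t^3 / 3.
    Hence the position of [c] relative to [D] does not matter. *)
Lemma integral_bump_le (R : realType) (t c : R) (D : set R) : 0 < t ->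
  measurable D ->
  (\int[lebesgue_measure]_(x in D) (bump t c x)%:E <= (4 / 3 * t ^+ 3)%:E)%E.
Proof.
move=> t0 mD.
have bump_ge0 x : (0 <= (bump t c x)%:E)%E by rewrite lee_fin le_max lexx.
have mb : measurable_fun setT (EFin \o bump t c).
  by apply/measurable_EFinP; exact: measurable_bump.
apply: (@le_trans _ _ (\int[lebesgue_measure]_x (bump t c x)%:E)%E).
  exact: ge0_subset_integral.
pose I := [set` `[c - t, c + t]].
have Iin x : (x \in I) = (0 <= t ^+ 2 - (x - c) ^+ 2).
  rewrite /I mem_setE in_itv/= subr_ge0 -(real_normK (num_real (x - c))).
  rewrite ler_sqr ?nnegrE ?(ltW t0)// ler_norml.
  by apply/idP/idP => /andP[? ?]; lra.
pose F (x : R) := t ^+ 2 * x - (x - c) ^+ 3 / 3.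
have dF (x : R) : is_derive x 1 F (t ^+ 2 - (x - c) ^+ 2).
  by apply: is_derive_eq; rewrite /GRing.scale/=; field.
(* Membership in [I] is exactly the sign test made by the maximum, so [bump] is the parabola
   extended by 0 outside [I]. *)
have -> : (\int[lebesgue_measure]_x (bump t c x)%:E
    = \int[lebesgue_measure]_(x in I) (t ^+ 2 - (x - c) ^+ 2)%:E)%E.
  rewrite [RHS]integral_mkcond; apply: eq_integral => x _.
  rewrite /patch Iin /bump; case: leP => //.
rewrite (integral_is_derive _ _ dF).
- by rewrite lee_fin le_eqVlt; apply/orP; left; apply/eqP; rewrite /F; field.
- lra.
- exact: continuous_sub_sqr.
Qed.

(** * The squared distance to a finite set *)

Lemma min_sqdist_ge0 (R : realType) (A : {fset R}) (x : R) :
  (0 <= min_sqdist A x)%E.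
Proof. by apply: le_bigmin => // c _; rewrite lee_fin sqr_ge0. Qed.

Lemma min_sqdist_le (R : realType) (A : {fset R}) (c x : R) : c \in A ->
  (min_sqdist A x <= ((x - c) ^+ 2)%:E)%E.
Proof.
move=> cA; rewrite -[_ ^+ 2]real_normK ?num_real//.
exact: (@ge_bigmin_seq _ _ R (enum_fset A) +oo%E c predT (fun c => (`|x - c| ^+ 2)%:E)%E).
Qed.

Lemma measurable_min_sqdist (R : realType) (A : {fset R}) :
  measurable_fun setT (min_sqdist A).
Proof.
rewrite /min_sqdist; elim: (enum_fset A) => [|c s IH].
  by under eq_fun do rewrite big_nil; exact: measurable_cst.
under eq_fun do rewrite big_cons; apply: measurable_mine => //.
apply/measurable_EFinP; apply: measurable_funX.
by apply: measurableT_comp => //; apply: measurable_funB.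
Qed.

Lemma sqr_le_min_sqdistD (R : realType) (A : {fset R}) (t x : R) :
  ((t ^+ 2)%:E <= min_sqdist A x + \sum_(c <- A) (bump t c x)%:E)%E.
Proof.
have bump_ge0 c : 0 <= bump t c x by rewrite le_max lexx.
(* The bound is checked against each candidate of the minimum: the neutral [+oo], which settles
   empty [A], and each [c] in [A], for which its own bump suffices since the others are
   nonnegative. *)
rewrite sumEFin -leeBlDr// -EFinB /min_sqdist [leRHS]big_seq.
apply: le_bigmin => [|c cA]; first by rewrite leey.
rewrite lee_fin real_normK ?num_real// lerBlDr -lerBlDl.
apply: (@le_trans _ _ (bump t c x)); first by rewrite le_max lexx orbT.
by rewrite (big_fsetD1 c)//= lerDl; apply: sumr_ge0.
Qed.

(** * Lower and upper bounds for the error integral *)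

Lemma quant_error_ge (R : realType) (a b : R) (ab : a < b) (A : {fset R})
    (m : nat) : (0 < m)%N -> (#|` A| <= m)%N ->
  (((a - b) ^+ 2 / 12 / m%:R ^+ 2)%:E
    <= \int[uniform_prob ab]_x min_sqdist A x)%E.
Proof.
move=> m0 Am; have mR : 0 < m%:R :> R by rewrite ltr0n.
have mA := @measurable_min_sqdist _ A.
rewrite integral_uniform//; last exact: min_sqdist_ge0.
have ba : 0 < b - a by rewrite subr_gt0.
(* This [t] maximizes t^2 (b - a) - 4 m t^3 / 3, the lower bound obtained below for the integral
   over [a, b]. *)
pose t := (b - a) / (2 * m%:R).
have t0 : 0 < t by rewrite divr_gt0// mulr_gt0.
have mI : measurable `[a, b] by exact: measurable_itv.
have mbump c : measurable_fun `[a, b] (EFin \o bump t c).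
  by apply/measurable_EFinP/measurable_funTS; exact: measurable_bump.
have bump_ge0 c x : (0 <= (bump t c x)%:E)%E by rewrite lee_fin le_max lexx.
set I := (\int[_]_(x in _) _)%E.
have : ((t ^+ 2 * (b - a))%:E <= I + (m%:R * (4 / 3 * t ^+ 3))%:E)%E.
  have -> : ((t ^+ 2 * (b - a))%:E
      = \int[lebesgue_measure]_(x in `[a, b]) (t ^+ 2)%:E)%E.
    by rewrite integral_cst//= lebesgue_measure_itv/= lte_fin ab -EFinD -EFinM.
  apply: (@le_trans _ _ (\int[lebesgue_measure]_(x in `[a, b])
      (min_sqdist A x + \sum_(c <- A) (bump t c x)%:E)%E)%E).
    apply: ge0_le_integral => //.
    - by move=> x _; rewrite lee_fin sqr_ge0.
    - apply: emeasurable_funD; first exact: measurable_funTS.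
      exact: emeasurable_sum.
    - by move=> x _; exact: sqr_le_min_sqdistD.
  rewrite ge0_integralD//.
  - rewrite leeD2l// ge0_integral_sum//.
    apply: (@le_trans _ _ (\sum_(c <- A) (4 / 3 * t ^+ 3)%:E)%E).
      by apply: lee_sum => c _; exact: integral_bump_le.
    rewrite sumEFin lee_fin big_const_seq count_predT iter_addr_0.
    rewrite -[leLHS]mulr_natl ler_wpM2r ?ler_nat//.
    by rewrite mulr_ge0// exprn_ge0// ltW.
  - by move=> x _; exact: min_sqdist_ge0.
  - exact: measurable_funTS.
  - by move=> x _; exact: sume_ge0.
  - exact: emeasurable_sum.
(* The bump term is finite, so it can be moved across without knowing that [I] is. *)
rewrite -leeBlDr// -EFinB => tI.
apply: (@le_trans _ _ ((b - a)^-1%:E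
    * (t ^+ 2 * (b - a) - m%:R * (4 / 3 * t ^+ 3))%:E)%E); last first.
  by rewrite lee_wpmul2l// lee_fin invr_ge0 ltW.
rewrite -EFinM lee_fin le_eqVlt; apply/orP; left; apply/eqP; rewrite /t.
by field; rewrite !gt_eqF.
Qed.

(** Induction appends one cell of width 2 t on the right and bounds the minimum there by the
    distance to its midpoint. [A] may contain further points, which leaves room for the conditional
    set. *)
Lemma integral_min_sqdist_le (R : realType) (a t : R) (k : nat) (A : {fset R}) :
  0 < t -> (forall i, (i < k)%N -> a + i%:R * (2 * t) + t \in A) ->
  (\int[lebesgue_measure]_(x in `[a, (a + k%:R * (2 * t))%R]) min_sqdist A x
    <= (k%:R * (2 / 3 * t ^+ 3))%:E)%E.
Proof.
move=> t0; elim: k => [|k IH] cA.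
  by rewrite mul0r addr0 set_itv1 integral_set1 mul0r.
have mA D : measurable_fun D (min_sqdist A).
  by apply: measurable_funTS; exact: measurable_min_sqdist.
pose c := a + k%:R * (2 * t) + t; set d := a + k%:R * (2 * t) in IH.
have kt : 0 <= k%:R * (2 * t) by rewrite !mulr_ge0// ltW.
have -> : a + k.+1%:R * (2 * t) = c + t by rewrite -natr1 /c; ring.
(* Cutting just before [d] makes the pieces disjoint; the endpoint is put back for the induction
   hypothesis without changing the integral. *)
rewrite (@itv_bndbnd_setU _ _ _ (BLeft d)); last 2 first.
- by rewrite bnd_simp lerDl.
- rewrite bnd_simp /c -/d; lra.
rewrite ge0_integral_setU//; first last.
- apply/disj_set2P/seteqP; split => // x [] /=; rewrite !in_itv/=.
  by move=> /andP[_ xd] /andP[dx _]; rewrite ltNge dx in xd.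
- by move=> x _; exact: min_sqdist_ge0.
- exact: mA.
rewrite -natr1 mulrDl mul1r EFinD; apply: leeD.
  rewrite integral_itv_bndo_bndc//; apply: IH => i ik.
  by apply: cA; rewrite ltnS ltnW.
have -> : d = c - t by rewrite /c -/d addrK.
rewrite -(integral_sqr_centered c t0); apply: ge0_le_integral => //.
- by move=> x _; exact: min_sqdist_ge0.
- exact: mA.
- apply/measurable_EFinP; apply: measurable_funTS.
  by apply: continuous_measurable_fun; exact: continuous_sqrB.
- by move=> x _; apply: min_sqdist_le; exact: cA.
Qed.

Lemma quant_error_le (R : realType) (a b : R) (ab : a < b) (A : {fset R})
    (k : nat) : (0 < k)%N ->
  (forall i, (i < k)%N -> a + (2 * i + 1)%:R * ((b - a) / (2 * k%:R)) \in A) ->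
  (\int[uniform_prob ab]_x min_sqdist A x
    <= ((a - b) ^+ 2 / 12 / k%:R ^+ 2)%:E)%E.
Proof.
move=> k0 cA; have kR : 0 < k%:R :> R by rewrite ltr0n.
have ba : 0 < b - a by rewrite subr_gt0.
rewrite integral_uniform//; first last.
- exact: min_sqdist_ge0.
- exact: measurable_min_sqdist.
pose t := (b - a) / (2 * k%:R).
have t0 : 0 < t by rewrite divr_gt0// mulr_gt0.
have bE : a + k%:R * (2 * t) = b by rewrite /t; field; rewrite gt_eqF.
have := @integral_min_sqdist_le R a t k A t0; rewrite bE => tI.
apply: (@le_trans _ _ ((b - a)^-1%:E * (k%:R * (2 / 3 * t ^+ 3))%:E)%E).
  rewrite lee_wpmul2l//; first by rewrite lee_fin invr_ge0 ltW.
  apply: tI => i /cA; rewrite -/t natrD natrM.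
  by congr (_ \in A); ring.
rewrite -EFinM lee_fin le_eqVlt; apply/orP; left; apply/eqP; rewrite /t.
by field; rewrite !gt_eqF.
Qed.

Lemma cond_quant_error_bounds (R : realType) (a b : R) (ab : a < b)
    (beta : {fset R}) (n : nat) : (#|` beta| < n)%N ->
  (((a - b) ^+ 2 / 12 / n%:R ^+ 2)%:E
     <= cond_quant_error (uniform_prob ab) beta n
     <= ((a - b) ^+ 2 / 12 / (n - #|` beta|)%:R ^+ 2)%:E)%E.
Proof.
move=> bn; have n0 : (0 < n)%N by apply: leq_ltn_trans bn.
apply/andP; split.
  apply: le_ereal_inf_tmp => _ [alpha /= alphan <-].
  apply: quant_error_ge => //; rewrite cardfsU.
  (* Points common to [alpha] and [beta] only lower the cardinal of the union. *)
  apply: leq_trans (leq_subr _ _) _.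
  by rewrite -(subnK (ltnW bn)) leq_add2r.
set k := (n - _)%N; have k0 : (0 < k)%N by rewrite subn_gt0.
pose s := [seq a + (2 * i + 1)%:R * ((b - a) / (2 * k%:R)) | i <- iota 0 k].
apply: ge_ereal_inf; exists (\int[uniform_prob ab]_x
    min_sqdist ([fset x in s] `|` beta)%fset x)%E.
  exists [fset x in s]%fset => //=.
  (* Only an upper bound on the cardinal is required, so the midpoints need not be proved
     distinct. *)
  by rewrite card_fseq (leq_trans (size_undup _))// size_map size_iota.
apply: quant_error_le => // i ik.
rewrite in_fsetU inE/=; apply/orP; left; apply/mapP; exists i => //.
by rewrite mem_iota.
Qed.

(** * Passage to the limit *)

Lemma cvg_ratio_subn (R : realType) (l : nat) :
  n%:R / (n - l)%:R @[n --> \oo] --> (1 : R).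
Proof.
(* Shifting by [l.+1] rather than [l] keeps the denominator nonzero and turns the ratio into 1 + l /
   (n + 1). *)
rewrite -(cvg_shiftn l.+1).
have lim1 : 1 + l%:R * harmonic n @[n --> \oo] --> (1 + l%:R * 0 : R).
  apply: cvgD; first exact: cvg_cst.
  by apply: cvgM; [exact: cvg_cst | exact: cvg_harmonic].
rewrite mulr0 addr0 in lim1; apply: cvg_trans lim1; apply: near_eq_cvg.
near=> n; rewrite /harmonic/=.
by rewrite addnS -addSn addnK natrD mulrDl divff// pnatr_eq0.
Unshelve. all: by end_near. Qed.

Lemma cvg_natV_sqr (R : realType) : (n%:R ^+ 2)^-1 @[n --> \oo] --> (0 : R).
Proof.
rewrite -cvg_shiftS.
have lim0 : harmonic n * harmonic n @[n --> \oo] --> (0 * 0 : R).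
  by apply: cvgM; exact: cvg_harmonic.
rewrite mulr0 in lim0; apply: cvg_trans lim0; apply: near_eq_cvg.
by near=> n; rewrite /harmonic/= -exprVn expr2.
Unshelve. all: by end_near. Qed.

(** Both bounds depend on [beta] only through its cardinal, a fixed shift of [n] that the limit
    forgets; so one squeeze serves all conditional sets. *)
Lemma is_cond_quant_coef_uniform (R : realType) (a b : R) (ab : a < b)
    (beta : {fset R}) :
  is_cond_quant_coef 1 (uniform_prob ab) beta ((a - b) ^+ 2 / 12).
Proof.
set C := _ / 12; set l := #|` beta|.
pose e := cond_quant_error (uniform_prob ab) beta.
(* The upper bound for [e n], multiplied by n^2. *)
pose u n : R := C * (n%:R / (n - l)%:R) ^+ 2.
have uC : u n @[n --> \oo] --> C.
  have lim1 : C * (n%:R / (n - l)%:R * (n%:R / (n - l)%:R)) @[n --> \oo]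
      --> (C * (1 * 1) : R).
    by apply: cvgM; [exact: cvg_cst | apply: cvgM; exact: cvg_ratio_subn].
  by rewrite !mulr1 in lim1.
have e_bounds : \forall n \near \oo, [/\ 0 < n%:R :> R,
    ((C / n%:R ^+ 2)%:E <= e n)%E & (e n <= (u n / n%:R ^+ 2)%:E)%E].
  near=> n.
  have ln : (l < n)%N by near: n; exact: nbhs_infty_gt.
  have n0 : 0 < n%:R :> R by rewrite ltr0n (leq_ltn_trans _ ln).
  have /andP[eC eu] := cond_quant_error_bounds ab ln.
  split => //; apply: (le_trans eu).
  rewrite lee_fin le_eqVlt; apply/orP; left; apply/eqP; rewrite /u -/C -/l.
  by field; rewrite !gt_eqF// ltr0n subn_gt0.
have C0 : 0 <= C by rewrite divr_ge0// sqr_ge0.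
(* The limit error vanishes, so nothing is subtracted in the coefficient. *)
have e0 : e n @[n --> \oo] --> 0%E.
  apply: (@squeeze_cvge _ _ _ _ (fun=> 0%E) e
    (fun n => (u n / n%:R ^+ 2)%:E)).
  - near=> n; have [n0 eC eu] : [/\ 0 < n%:R :> R,
      ((C / n%:R ^+ 2)%:E <= e n)%E & (e n <= (u n / n%:R ^+ 2)%:E)%E].
      by near: n.
    by rewrite eu andbT (le_trans _ eC)// lee_fin divr_ge0// sqr_ge0.
  - exact: cvg_cst.
  - apply: cvg_EFin; first by near=> n.
    have lim0 : u n * (n%:R ^+ 2)^-1 @[n --> \oo] --> (C * 0 : R).
      by apply: cvgM => //; exact: cvg_natV_sqr.
    by rewrite mulr0 in lim0.
have lim0 : cond_quant_error_lim (uniform_prob ab) beta = 0%E.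
  exact: cvg_lim e0.
split; first by apply/cvg_ex; exists 0%E.
rewrite lim0 divr1.
apply: (@squeeze_cvge _ _ _ _ (fun=> C%:E) _ (fun n => (u n)%:E)).
- near=> n; have [n0 eC eu] : [/\ 0 < n%:R :> R,
    ((C / n%:R ^+ 2)%:E <= e n)%E & (e n <= (u n / n%:R ^+ 2)%:E)%E].
    by near: n.
  have n2 : n%:R ^+ 2 != 0 :> R by rewrite expf_neq0// gt_eqF.
  have n2_ge0 : (0 <= (n%:R ^+ 2 : R)%:E)%E by rewrite lee_fin sqr_ge0.
  (* With [C] and [u n] written as multiples of n^2, both inequalities follow by monotonicity of the
     product in [\bar R]. *)
  have mulV x : (x%:E = (n%:R ^+ 2 : R)%:E * (x / n%:R ^+ 2)%:E)%E.
    by rewrite -EFinM mulrC divfK.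
  by rewrite sube0 powR_mulrn// (mulV C) (mulV (u n)) !lee_wpmul2l.
- exact: cvg_cst.
- by apply: cvg_EFin; first by near=> n.
Unshelve. all: by end_near. Qed.

Theorem theorem3p2 (R : realType) (a b : R) (ab : a < b) :
  [/\ 0 < (a - b) ^+ 2 / 12,
      is_cond_quant_coef 1 (uniform_prob ab) [fset a; b]%fset
        ((a - b) ^+ 2 / 12),
      is_cond_quant_coef 1 (uniform_prob ab) [fset a]%fset
        ((a - b) ^+ 2 / 12)
    & is_cond_quant_coef 1 (uniform_prob ab) [fset b]%fset
        ((a - b) ^+ 2 / 12)].
Proof.
split; [|exact: is_cond_quant_coef_uniform..].
by rewrite divr_gt0// exprn_even_gt0//= subr_eq0 lt_eqF.
Qed.
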